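(* Let $(X,m,E)$ be a universal measurable graph (respectively, for an integer $s>2$, a $K_s$-free universal measurable graph). Let $X^{\infty}=\prod_{n=1}^{\infty}(X,m)$ and let $F$ be the map from $X^{\infty}$ to the space of infinite symmetric $\{0,1\}$-matrices with zero diagonal given by $$F(\{x_i\})=\{e_{i,j}\}_{i,j\in\mathbb{N}},\qquad e_{i,j}=\chi_E(x_i,x_j)\ \ (i\ne j),\quad e_{i,i}=0,$$ where $\chi_E$ is the characteristic function of $E\subset X\times X$. For a Borel measure $\alpha$ on $X^{\infty}$ put $[F^*(\alpha)](C)=\alpha(F^{-1}(C))$. Then $\mu_{\{X,m,E\}}:=F^*(m^{\infty})$ is an $\mathfrak{S}^{\mathbb{N}}$-invariant probability measure concentrated on the set of universal (respectively, $K_s$-free universal) homogeneous countable graphs.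
   Context: Graphs are undirected, without loops or multiple edges. Graphs with vertex set $\mathbb{N}$ are identified with their adjacency matrices, i.e. infinite symmetric $\{0,1\}$-matrices with zero diagonal, with the weak (product) topology and its Borel $\sigma$-field. $\mathfrak{S}^{\mathbb{N}}$ is the group of all permutations of $\mathbb{N}$, acting by simultaneous permutation of rows and columns. $K_s$ is the complete graph on $s$ vertices. A countable graph (respectively, countable $K_s$-free graph) $\Gamma$ is universal (respectively, $K_s$-free universal), homogeneity being included in the term, if every finite graph (respectively, every finite $K_s$-free graph) embeds in $\Gamma$ as an induced subgraph and every isomorphism between two finite induced subgraphs of $\Gamma$ extends to an automorphism of $\Gamma$. A measurable graph is a triple $(X,m,E)$ where $(X,m)$ is a standard Lebesgue space with continuous (atomless) probability measure $m$ and $E\subset X\times X$ is a symmetric measurable set of positive $(m\times m)$-measure. Put $E_x=\{y:(x,y)\in E\}$. It is pure if the map $x\mapsto E_x\pmod 0$ from $X$ to the algebra of mod $0$ classes of measurable sets is injective mod $0$, i.e. injective on a set of full measure. A pure measurable graph is universal (respectively, $K_s$-free universal) if for $m^{\infty}$-almost all sequences $(x_k)_{k\ge1}\in X^{\infty}$ the graph induced by $E$ on the vertices $x_1,x_2,\dots$ is a universal (respectively, $K_s$-free universal) countable graph. *)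

(* Defs.v *)
From HB Require Import structures.
From mathcomp Require Import all_boot all_order all_algebra.
From mathcomp Require Import all_classical all_reals all_analysis.

Set Implicit Arguments.
Unset Strict Implicit.
Unset Printing Implicit Defensive.

Import Order.TTheory GRing.Theory Num.Theory.

Local Open Scope classical_set_scope.
Local Open Scope ring_scope.

Record graphN := GraphN {
  adj : nat -> nat -> bool;
  adj_sym : symmetric adj;
  adj_irr : irreflexive adj
}.

Lemma empty_sym : symmetric (fun _ _ : nat => false).
Proof. by []. Qed.

Lemma empty_irr : irreflexive (fun _ _ : nat => false).
Proof. by []. Qed.

HB.instance Definition _ := gen_eqMixin graphN.
HB.instance Definition _ := gen_choiceMixin graphN.
HB.instance Definition _ := isPointed.Build graphN (GraphN empty_sym empty_irr).

Definition entries (G : graphN) : prod_topology (fun _ : nat * nat => bool) :=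
  fun ij => adj G ij.1 ij.2.

(* [graphN] with the topology induced by the product topology on matrices
   (the factors [bool] are discrete), then with its Borel sigma-field. *)
Definition graphN_top : topologicalType := initial_topology entries.

Definition graphN_borel : measurableType _ :=
  g_sigma_algebraType (open : set (set graphN_top)).

Definition is_Kfree (s : nat) (V : Type) (e : rel V) : Prop :=
  ~ exists f : 'I_s -> V,
      injective f /\ (forall i j, i != j -> e (f i) (f j)).

Definition embeds (T : finType) (e : rel T) (G : graphN) : Prop :=
  exists f : T -> nat,
    injective f /\ (forall x y, adj G (f x) (f y) = e x y).

Definition homogeneous (G : graphN) : Prop :=
  forall (A B : set nat) (h : nat -> nat),
    finite_set A -> set_bij A B h ->
    (forall x y, A x -> A y -> adj G (h x) (h y) = adj G x y) ->
    exists phi : nat -> nat,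
      [/\ bijective phi,
          forall x y, adj G (phi x) (phi y) = adj G x y &
          forall x, A x -> phi x = h x].

Definition universal (G : graphN) : Prop :=
  (forall (T : finType) (e : rel T),
     symmetric e -> irreflexive e -> embeds e G) /\
  homogeneous G.

Definition Kfree_universal (s : nat) (G : graphN) : Prop :=
  [/\ is_Kfree s (adj G),
      (forall (T : finType) (e : rel T),
         symmetric e -> irreflexive e -> is_Kfree s e -> embeds e G) &
      homogeneous G].

Lemma relabel_sym (sigma : nat -> nat) (G : graphN) :
  symmetric (fun i j => adj G (sigma i) (sigma j)).
Proof. by move=> i j; exact: adj_sym. Qed.

Lemma relabel_irr (sigma : nat -> nat) (G : graphN) :
  irreflexive (fun i j => adj G (sigma i) (sigma j)).
Proof. by move=> i; exact: adj_irr. Qed.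

(* For bijective [sigma], the action of the permutation [sigma^-1] on rows and
   columns simultaneously. *)
Definition relabel (sigma : nat -> nat) (G : graphN) : graphN :=
  GraphN (relabel_sym sigma G) (relabel_irr sigma G).

Definition perm_invariant (R : realType) (mu : set graphN_borel -> \bar R) :=
  forall sigma : nat -> nat, bijective sigma ->
  forall C : set graphN_borel, measurable C ->
    mu (relabel sigma @^-1` C) = mu C.

(* For a probability [mu], the Caratheodory sigma-field [mu^*.-cara.-measurable]
   is the completion of the sigma-field of [mu]; [completed mu] is the completed
   measure on it. *)
Notation completed mu := (@completed_measure_extension _ _ _ mu).

(* Complete, and isomorphic mod 0 to the completion of some Borel probability
   on the real line (atoms allowed). *)
Definition standard_lebesgue_space d (X : measurableType d) (R : realType)
    (m : probability X R) : Prop :=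
  measure_is_complete m /\
  exists (nu : probability (measurableTypeR R) R)
         (A : set X) (B : set R) (f : X -> R),
    [/\ measurable A /\ m A = 1%E,
        ((nu^*)%mu.-cara.-measurable B /\
         completed nu B = 1%E),
        set_bij A B f,
        (forall S, S `<=` A ->
           measurable S <-> (nu^*)%mu.-cara.-measurable (f @` S)) &
        (forall S, S `<=` A -> measurable S ->
           m S = completed nu (f @` S))].

Definition atomless d (X : measurableType d) (R : realType)
    (m : set X -> \bar R) : Prop :=
  forall A, measurable A -> (0 < m A)%E ->
    exists B, [/\ measurable B, B `<=` A, (0 < m B)%E & (m B < m A)%E].

Definition cylinders d (X : measurableType d) : set (set (nat -> X)) :=
  [set C | exists i (A : set X), measurable A /\ C = [set x | A (x i)]].
Arguments cylinders {d} X.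

Definition powN d (X : measurableType d) : measurableType _ :=
  g_sigma_algebraType (cylinders X).

(* [P] is the infinite product measure m^oo; this determines [P] uniquely. *)
Definition infinite_power d (X : measurableType d) (R : realType)
    (m : probability X R) (P : probability (powN X) R) : Prop :=
  forall (n : nat) (A : nat -> set X), (forall i, measurable (A i)) ->
    P [set x | forall i, (i < n)%N -> A i (x i)] = (\prod_(i < n) m (A i))%E.

(* As usual for Lebesgue spaces, X * X carries the completed product. *)
Record measurable_graph d (X : measurableType d) (R : realType)
    (m : probability X R) := MeasurableGraph {
  edges :> set (X * X);
  edges_sym : forall x y, edges (x, y) -> edges (y, x);
  edges_measurable : ((m \x m)%E^*)%mu.-cara.-measurable edges;
  edges_gt0 : (0 < completed (m \x m)%E edges)%E
}.

Definition pure d (X : measurableType d) (R : realType)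
    (m : probability X R) (E : measurable_graph m) : Prop :=
  exists X0 : set X, {ae m, forall x, X0 x} /\
    forall x y, X0 x -> X0 y ->
      m.-negligible (xsection E x `+` xsection E y) -> x = y.

Section sample_graph.
Context d (X : measurableType d) (R : realType) (m : probability X R).
Variables (E : measurable_graph m) (x : nat -> X).

Definition sample_adj (i j : nat) : bool := (i != j) && `[< edges E (x i, x j) >].

Lemma sample_adj_sym : symmetric sample_adj.
Proof.
move=> i j; rewrite /sample_adj eq_sym; congr (_ && _).
by apply: asbool_equiv_eq; split; exact: edges_sym.
Qed.

Lemma sample_adj_irr : irreflexive sample_adj.
Proof. by move=> i; rewrite /sample_adj eqxx. Qed.

Definition sample_graph : graphN_borel := GraphN sample_adj_sym sample_adj_irr.

End sample_graph.

Definition universal_measurable_graph d (X : measurableType d) (R : realType)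
    (m : probability X R) (P : probability (powN X) R)
    (E : measurable_graph m) : Prop :=
  pure E /\ {ae P, forall x, universal (sample_graph E x)}.

Definition Kfree_universal_measurable_graph (s : nat)
    d (X : measurableType d) (R : realType)
    (m : probability X R) (P : probability (powN X) R)
    (E : measurable_graph m) : Prop :=
  pure E /\ {ae P, forall x, Kfree_universal s (sample_graph E x)}.

(* [edges E] is only measurable for the completed product, so [sample_graph E]
   is measurable for, and [mu] is the image of, the completion of [P] = m^oo. *)
Definition is_graph_law d (X : measurableType d) (R : realType)
    (m : probability X R) (P : probability (powN X) R)
    (E : measurable_graph m) (mu : set graphN_borel -> \bar R) : Prop :=
  measurable_fun [set: caratheodory_type (P^*)%mu] (sample_graph E) /\
  forall C : set graphN_borel, measurable C ->
    mu C = completed P (sample_graph E @^-1` C).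

(* Main.v *)
(* A set that is Caratheodory-measurable for P^* differs from a measurable set
   by a subset of a P-null set, so it pulls back along measure-preserving maps,
   with the same outer measure. For i <> j, x |-> (x_i, x_j) carries m^oo to
   m \x m, which makes the sampling map measurable for the completion of m^oo;
   permuting coordinates preserves m^oo and relabels the sampled graph, which
   gives invariance. For the concentration, the set of universal graphs must be
   Borel: by back-and-forth, homogeneity is equivalent to a one-point extension
   property of finite partial isomorphisms, which only involves countable
   quantifiers. *)
Require Import Defs.
From HB Require Import structures.
From mathcomp Require Import all_boot all_order all_algebra.
From mathcomp Require Import all_classical all_reals all_analysis.

Set Implicit Arguments.
Unset Strict Implicit.
Unset Printing Implicit Defensive.

Import Order.TTheory GRing.Theory Num.Theory.

Local Open Scope classical_set_scope.
Local Open Scope ring_scope.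

(** * Completion of a probability *)

Section completion.
Context d (T : measurableType d) (R : realType) (mu : probability T R).
Local Open Scope ereal_scope.

Lemma mu_ext_fin_num A : (mu^*)%mu A \is a fin_num.
Proof.
rewrite ge0_fin_numE ?outer_measure_ge0//.
rewrite (@le_lt_trans _ _ ((mu^*)%mu setT)) ?le_outer_measure//.
by rewrite measurable_mu_extE//= [X in X < _]probability_setT ltry.
Qed.

(** The outer measure is finite, so for each [n] some measurable cover has total mass within
    [1/(n+1)] of it; the hull is the intersection of the unions of these covers. *)
Lemma measurable_hull A : exists B,
  [/\ measurable B, A `<=` B & mu B = (mu^*)%mu A].
Proof.
have pos n : (0 < n.+1%:R^-1 :> R)%R by rewrite invr_gt0.
have cover n : exists F : (set T)^nat, measurable_cover A F /\
    \sum_(k <oo) mu (F k) < (mu^*)%mu A + n.+1%:R^-1%:E.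
  have [_ [F AF <-] ltF] := lb_ereal_inf_adherent (pos n) (mu_ext_fin_num A).
  by exists F.
have [F /all_and2 [AF ltF]] := choice cover.
have mF n k : measurable (F n k) by exact: (AF n).1.
have AF' : A `<=` \bigcap_n \bigcup_k F n k.
  by move=> x Ax n _; exact: (AF n).2.
have mB : measurable (\bigcap_n \bigcup_k F n k).
  by apply: bigcapT_measurable => n; exact: bigcupT_measurable.
exists (\bigcap_n \bigcup_k F n k); split => //.
apply/eqP; rewrite eq_le; apply/andP; split; last first.
  by rewrite -(measurable_mu_extE mu mB) le_outer_measure.
apply/lee_addgt0Pr => _/posnumP[e]; near \oo => n.
apply: (@le_trans _ _ (mu (\bigcup_k F n k))).
  by apply: le_measure; rewrite ?inE//; [exact: bigcupT_measurable|exact: bigcap_inf].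
apply: (@le_trans _ _ (\sum_(k <oo) mu (F n k))).
  by apply: measure_sigma_subadditive => //; exact: bigcupT_measurable.
rewrite (le_trans (ltW (ltF n)))// leeD// lee_fin ltW//.
by near: n; exact: near_infty_natSinv_lt.
Unshelve. all: by end_near. Qed.

Lemma mu_ext0_cara A :
  (mu^*)%mu A = 0 -> (mu^*)%mu.-cara.-measurable A.
Proof.
move=> A0; have [B [mB AB muB]] := measurable_hull A.
apply: measure_is_complete_caratheodory; exists B; split=> //.
  exact: caratheodory_measurable_mu_ext.
by rewrite -A0 -muB; exact: measurable_mu_extE.
Qed.

(** Testing the Caratheodory condition of [A] on its hull [B] splits the outer measure of [B] into
    those of [A] and of [B] minus [A]. The first already equals that of [B] and is finite, so the
    second is zero; [N] is a hull of the difference. *)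
Lemma cara_sandwich (A : set T) :
  (mu^*)%mu.-cara.-measurable A -> exists B N : set T,
  [/\ measurable B, measurable N, mu N = 0, A `<=` B & B `\` A `<=` N].
Proof.
move=> mA; have [B [mB AB muB]] := measurable_hull A.
have [N [mN BAN muN]] := measurable_hull (B `\` A).
exists B, N; split => //; apply: (etrans muN).
have BA : (mu^*)%mu B = (mu^*)%mu A by rewrite -muB; exact: measurable_mu_extE.
have /(_ B) := mA; rewrite -setDE (setIidr AB) => /= BE.
rewrite -(addeK ((mu^*)%mu (B `\` A)) (mu_ext_fin_num A)) [X in X - _]addeC.
have <- : (mu^*)%mu B = (mu^*)%mu A + (mu^*)%mu (B `\` A) by exact: BE.
by rewrite BA subee// mu_ext_fin_num.
Qed.

Lemma mu_ext_sub_null (N A : set T) :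
  measurable N -> mu N = 0 -> A `<=` N -> (mu^*)%mu A = 0.
Proof.
move=> mN N0 AN; apply/eqP; rewrite eq_le outer_measure_ge0 andbT -N0.
by rewrite -(measurable_mu_extE mu mN) le_outer_measure.
Qed.

Lemma mu_ext_setD_null (B A : set T) : measurable B -> A `<=` B ->
  (mu^*)%mu (B `\` A) = 0 -> (mu^*)%mu A = mu B.
Proof.
move=> mB AB BA0; apply/eqP; rewrite eq_le.
rewrite -(measurable_mu_extE mu mB) le_outer_measure//=.
rewrite -[leRHS]adde0 -BA0 -{1}(setDUK AB).
exact: outer_measureU2.
Qed.

End completion.

Section measure_preserving.
Context d1 d2 (T1 : measurableType d1) (T2 : measurableType d2) (R : realType).
Variables (mu1 : probability T1 R) (mu2 : probability T2 R) (f : T1 -> T2).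
Hypotheses (mf : measurable_fun setT f)
  (fE : forall B, measurable B -> mu1 (f @^-1` B) = mu2 B).
Local Open Scope ereal_scope.

Let mpre B : measurable B -> measurable (f @^-1` B).
Proof. by move=> mB; rewrite -[X in measurable X]setTI; exact: mf. Qed.

(** Only the measurable sets [B] and [N] of the sandwich need to be pulled back: the preimage of [N]
    is null and contains the difference of the preimages of [B] and [A]. *)
Lemma cara_preimage (A : set T2) : (mu2^*)%mu.-cara.-measurable A ->
  (mu1^*)%mu.-cara.-measurable (f @^-1` A) /\
  (mu1^*)%mu (f @^-1` A) = (mu2^*)%mu A.
Proof.
move=> /cara_sandwich[B [N [mB mN N0 AB BAN]]].
have D0 : (mu1^*)%mu (f @^-1` B `\` f @^-1` A) = 0.
  by apply: (@mu_ext_sub_null _ _ _ _ (f @^-1` N)); [exact: mpre|rewrite fE|move=> x /BAN].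
have AB1 : f @^-1` A `<=` f @^-1` B by exact: preimage_subset.
split.
  rewrite -(setIidr AB1) -setDD; apply: measurableD.
    exact/caratheodory_measurable_mu_ext/mpre.
  exact: mu_ext0_cara.
rewrite (mu_ext_setD_null (mpre mB))// (mu_ext_setD_null mB) ?fE//.
exact: mu_ext_sub_null BAN.
Qed.
End measure_preserving.

(** * The Borel sigma-field of graphs *)

Section countable_quantifiers.
Context d (T : measurableType d).

Lemma measurable_exists (I : countType) (P : I -> set T) :
  (forall i, measurable (P i)) -> measurable [set x | exists i, P i x].
Proof.
move=> mP; rewrite (_ : [set x | _] = \bigcup_i P i).
  exact: countable_bigcupT_measurable.
by apply/seteqP; split=> [x [i ?]|x [i _ ?]]; exists i.
Qed.

Lemma measurable_forall (I : countType) (P : I -> set T) :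
  (forall i, measurable (P i)) -> measurable [set x | forall i, P i x].
Proof.
move=> mP; rewrite (_ : [set x | _] = ~` [set x | exists i, (~` P i) x]).
  by apply/measurableC/measurable_exists => i; exact: measurableC.
apply/seteqP; split=> [x Px [i]|x nP i]; first exact.
by apply: contrapT => nPx; apply: nP; exists i.
Qed.

(** Serves for side conditions that do not depend on the point, such as bounds on indices. *)
Lemma measurable_prop_imply (Q : Prop) (A : set T) :
  measurable A -> measurable [set x | Q -> A x].
Proof.
move=> mA; have [q|nq] := pselect Q.
  by rewrite (_ : [set x | _] = A)//; apply/seteqP; split=> x /=; [exact|].
by rewrite (_ : [set x | _] = setT)//; apply/seteqP; split=> // x _ /nq.
Qed.

Lemma measurable_prop_and (Q : Prop) (A : set T) :
  measurable A -> measurable [set x | Q /\ A x].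
Proof.
move=> mA; have [q|nq] := pselect Q.
  by rewrite (_ : [set x | _] = A)//; apply/seteqP; split=> x //= [].
by rewrite (_ : [set x | _] = set0)//; apply/seteqP; split=> x // [].
Qed.

Lemma measurable_eqb (f g : T -> bool) :
  measurable [set x | f x] -> measurable [set x | g x] ->
  measurable [set x | f x = g x].
Proof.
move=> mf mg; rewrite (_ : [set x | _] = ([set x | f x] `&` [set x | g x]) `|`
    (~` [set x | f x] `&` ~` [set x | g x])).
  by apply: measurableU; apply: measurableI => //; exact: measurableC.
apply/seteqP; split=> x /=; last by case: (f x) (g x) => -[] [] //= [].
by case: (f x) (g x) => -[] //= _; [left|right].
Qed.

Lemma measurable_cstP (Q : Prop) : measurable [set _ : T | Q].
Proof.
by have [q|nq] := pselect Q; [rewrite (_ : [set _ | _] = setT)|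
  rewrite (_ : [set _ | _] = set0)]; rewrite //; apply/seteqP; split.
Qed.

End countable_quantifiers.

Lemma measurable_adj i j : measurable [set G : graphN_borel | adj G i j].
Proof.
apply: sub_sigma_algebra; exists [set M | M (i, j) = true].
  apply: (@open_comp _ _ (fun M : prod_topology _ => M (i, j)) [set true]).
    by move=> M _; exact: proj_continuous.
  exact: discrete_open.
by [].
Qed.

Lemma open_matrix_cylinder (V : set (prod_topology (fun _ : nat * nat => bool)))
    M : open V -> V M ->
  exists N, forall M', (forall i j, (i < N)%N -> (j < N)%N -> M' (i, j) = M (i, j)) -> V M'.
Proof.
move=> oV VM.
pose cyl N := [set M' : prod_topology (fun _ : nat * nat => bool) |
  forall i j, (i < N)%N -> (j < N)%N -> M' (i, j) = M (i, j)].
suff: filter_from [set: nat] cyl --> M.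
  by move/(_ V (open_nbhs_nbhs (conj oV VM))) => [N _ NV]; exists N.
(* The product topology is a supremum, so convergence of this filter may be
   tested one coordinate at a time. *)
have FF : Filter (filter_from [set: nat] cyl).
  apply: filter_from_filter; first by exists 0%N.
  move=> m n _ _; exists (maxn m n) => // M' M'M; split=> i j il jl;
    by apply: M'M; rewrite leq_max ?il ?jl ?orbT.
apply/cvg_sup => -[i j] A; rewrite /=
  (@nbhsE (initial_topology (fun M : nat * nat -> bool => M (i, j)))) => -[_ [[B oB <-] BM] BA].
exists (maxn i j).+1 => // M' M'M; apply: BA => /=.
by rewrite M'M// ltnS ?leq_maxl ?leq_maxr.
Qed.

(** The matrix space is second countable, so measurability of each entry suffices although the
    sigma-field is generated by all open sets. *)
Lemma measurable_fun_graph d (T : measurableType d) (f : T -> graphN_borel) :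
  (forall i j, measurable [set x | adj (f x) i j]) -> measurable_fun setT f.
Proof.
move=> mf; apply: (@measurability _ _ _ graphN_borel _ _
  (open : set (set graphN_top)) erefl).
move=> _ [_ [V oV <-] <-]; rewrite setTI.
(* An open set is the union of the cylinders it contains, each fixing a leading [N] by [N] block
   [k]; there are countably many such blocks. *)
rewrite (_ : _ @^-1` _ = [set x | exists N, exists k : {ffun 'I_N * 'I_N -> bool},
  (forall M, (forall p : 'I_N * 'I_N, M (val p.1, val p.2) = k p) -> V M) /\
  forall p : 'I_N * 'I_N, adj (f x) p.1 p.2 = k p]).
  apply: measurable_exists => N; apply: measurable_exists => k.
  apply: measurable_prop_and; apply: measurable_forall => p.
  by apply: measurable_eqb => //; exact: measurable_cstP.
apply/seteqP; split=> [x Vx|x /= [N [k [kV fk]]]]; last first.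
  by apply: kV => p; exact: fk.
have [N NV] := open_matrix_cylinder oV Vx.
exists N, [ffun p : 'I_N * 'I_N => adj (f x) p.1 p.2]; split=> [M Mk|p].
  by apply: NV => i j il jl; have := Mk (Ordinal il, Ordinal jl); rewrite ffunE.
by rewrite ffunE.
Qed.

(** * Homogeneity and back-and-forth *)

(* A finite list of pairs (x, y) encodes the partial map sending each x to y. *)
Definition partial_iso (G : graphN) (s : seq (nat * nat)) : Prop :=
  forall p q, p \in s -> q \in s ->
    ((p.1 == q.1) = (p.2 == q.2)) /\ adj G p.2 q.2 = adj G p.1 q.1.

(** Lists of pairs form a countable type, which keeps every quantifier here countable. With [y]
    outside the implication, the choice of [y] is a total function of [s] and [x]. *)
Definition extension_property (G : graphN) : Prop :=
  forall s x, exists y, partial_iso G s -> partial_iso G ((x, y) :: s).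

Definition flip (s : seq (nat * nat)) := [seq (p.2, p.1) | p <- s].

Lemma mem_flip s x y : ((x, y) \in flip s) = ((y, x) \in s).
Proof.
apply/mapP/idP => [[[a b] ab [-> ->]]|yx]; first exact: ab.
by exists (y, x).
Qed.

Lemma partial_iso_flip G s : partial_iso G s -> partial_iso G (flip s).
Proof.
move=> sG [x y] [x' y']; rewrite !mem_flip => /sG/[apply] /= -[-> ->].
by split.
Qed.

Lemma partial_iso_sub G s t :
  {subset s <= t} -> partial_iso G t -> partial_iso G s.
Proof. by move=> st tG p q /st pt /st; exact: tG. Qed.

(** An automorphism [phi] extending the partial map provides the new value [phi x]. *)
Lemma homogeneous_extension G : homogeneous G -> extension_property G.
Proof.
move=> homG s x.
have [sG|nsG] := pselect (partial_iso G s); last by exists 0%N.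
(* Total lookup function of the list, equal to the default 0 outside the domain. *)
pose h a := nth 0%N (unzip2 s) (index a (unzip1 s)).
have hE a b : (a, b) \in s -> h a = b.
  move=> ab; have a_s : a \in unzip1 s by apply/mapP; exists (a, b).
  have : (a, h a) \in s.
    rewrite /h -{1}(nth_index 0%N a_s) -[X in X \in s]nth_zip ?size_map//.
    by rewrite zip_unzip mem_nth// -(size_map fst) index_mem.
  by move=> /sG/(_ ab)[] /=; rewrite eqxx => /esym/eqP.
have dom a : a \in unzip1 s -> (a, h a) \in s.
  by move=> /mapP[[u v] uv ->]; rewrite (hE _ _ uv).
have [||phi [phi_bij phiG phih]] :=
    homG [set a | a \in unzip1 s] [set b | b \in unzip2 s] h (finite_seq _).
- split=> [a /= /dom ha|a b|b /= /mapP[[u v] uv ->]].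
  + by apply/mapP; exists (a, h a).
  + rewrite !inE /= => /dom ha /dom hb hab.
    by have [/= e _] := sG _ _ ha hb; apply/eqP; rewrite e hab.
  + by exists u; [apply/mapP; exists (u, v)|exact: hE].
- by move=> a b /= /dom ha /dom hb; have [] := sG _ _ ha hb.
have graph_phi p : p \in (x, phi x) :: s -> p.2 = phi p.1.
  rewrite inE => /predU1P[->//|]; case: p => a b ab /=.
  by rewrite phih ?(hE _ _ ab)//=; apply/mapP; exists (a, b).
exists (phi x) => _ p q /graph_phi -> /graph_phi ->; split=> //.
by rewrite (inj_eq (bij_inj phi_bij)).
Qed.

Section back_and_forth.
Variables (G : graphN) (ext : seq (nat * nat) -> nat -> nat).
Hypothesis extP :
  forall s x, partial_iso G s -> partial_iso G ((x, ext s x) :: s).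
Variable s0 : seq (nat * nat).
Hypothesis s0G : partial_iso G s0.

Definition forth s n := (n, ext s n) :: s.
(** Extending the inverse partial map at [n] puts [n] into the range. *)
Definition back s n := (ext (flip s) n, n) :: s.

Fixpoint stage n := if n is n'.+1 then back (forth (stage n') n') n' else s0.

Lemma partial_iso_back s n : partial_iso G s -> partial_iso G (back s n).
Proof.
move=> sG; have := partial_iso_flip (@extP _ n (partial_iso_flip sG)).
apply: partial_iso_sub => -[a b]; rewrite mem_flip !inE => /orP[/eqP[-> ->]|ab].
  by rewrite eqxx.
by rewrite mem_flip ab orbT.
Qed.

Lemma stage_iso n : partial_iso G (stage n).
Proof. by elim: n => //= n IH; apply: partial_iso_back; exact: extP. Qed.

Lemma sub_stage m n : (m <= n)%N -> {subset stage m <= stage n}.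
Proof.
elim: n => [|n IH]; first by rewrite leqn0 => /eqP ->.
rewrite leq_eqVlt => /predU1P[-> //|mn] p /(IH mn) pn.
by rewrite /= !inE pn !orbT.
Qed.

(** The stages increase, so both pairs lie in stage [maxn m n]; hence the union of all stages is a
    partial isomorphism. *)
Lemma stages_iso m n p q : p \in stage m -> q \in stage n ->
  ((p.1 == q.1) = (p.2 == q.2)) /\ adj G p.2 q.2 = adj G p.1 q.1.
Proof.
move=> /(sub_stage (leq_maxl m n)) pm /(sub_stage (leq_maxr m n)) qn.
exact: stage_iso pm qn.
Qed.

Lemma back_and_forth : exists phi : nat -> nat,
  [/\ bijective phi, forall x y, adj G (phi x) (phi y) = adj G x y &
      forall p, p \in s0 -> phi p.1 = p.2].
Proof.
(* [phi x] and [psi y] are the values inserted by [forth] and [back] on the way to stages [x.+1] and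
   [y.+1]. They are mutually inverse because pairs of the stages sharing one component share the
   other. *)
pose phi x := ext (stage x) x.
pose psi y := ext (flip (forth (stage y) y)) y.
have phi_stage x : (x, phi x) \in stage x.+1 by rewrite /= !inE eqxx orbT.
have psi_stage y : (psi y, y) \in stage y.+1 by rewrite /= !inE eqxx.
exists phi; split=> [|x y|p ps0].
- exists psi => x; apply/eqP.
    by have [/= -> _] := stages_iso (psi_stage (phi x)) (phi_stage x).
  by have [/= <- _] := stages_iso (phi_stage (psi x)) (psi_stage x).
- by have [] := stages_iso (phi_stage x) (phi_stage y).
- apply/eqP; have [/= <- _] := stages_iso (phi_stage p.1) (ps0 : p \in stage 0).
  by rewrite eqxx.
Qed.

End back_and_forth.

(** Back-and-forth starts from the graph of [h] over an enumeration of the finite set [A]. *)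
Lemma extension_homogeneous G : extension_property G -> homogeneous G.
Proof.
move=> extG A B h finA [_ h_inj _] hG.
have [ext extP] : exists ext, forall s x,
    partial_iso G s -> partial_iso G ((x, ext s x) :: s).
  have [ext extP] := choice (fun sx : seq (nat * nat) * nat => extG sx.1 sx.2).
  by exists (fun s x => ext (s, x)) => s x; exact: (extP (s, x)).
have [a Aa] : exists a : seq nat, A = [set` a] by apply/finite_seqP.
have [|phi [phi_bij phiG phih]] := back_and_forth extP (s0 := [seq (x, h x) | x <- a]).
  move=> _ _ /mapP[x xa ->] /mapP[y ya ->] /=.
  have [Ax Ay] : A x /\ A y by rewrite Aa.
  by split; [apply/eqP/eqP => [->//|]; apply: h_inj; rewrite inE|exact: hG].
exists phi; split=> // x; rewrite {1}Aa /= => xa.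
by apply: (phih (x, h x)); apply/mapP; exists x.
Qed.

Lemma homogeneousP G : homogeneous G <-> extension_property G.
Proof.
by split; [exact: homogeneous_extension|exact: extension_homogeneous].
Qed.

(** The definition quantifies over arbitrary maps of the naturals, an uncountable family; the
    extension property replaces it by countable quantifiers. *)
Lemma measurable_homogeneous : measurable [set G : graphN_borel | homogeneous G].
Proof.
have miso s : measurable [set G : graphN_borel | partial_iso G s].
  apply: measurable_forall => p; apply: measurable_forall => q.
  do 2!apply: measurable_prop_imply; apply: measurable_prop_and.
  by apply: measurable_eqb; exact: measurable_adj.
rewrite (_ : [set G | _] = [set G : graphN_borel | forall s x, exists y,
    partial_iso G s -> partial_iso G ((x, y) :: s)]); last first.
  by apply/seteqP; split=> G /homogeneousP.
apply: measurable_forall => s; apply: measurable_forall => x.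
apply: measurable_exists => y.
rewrite [X in measurable X](_ : _ = ~` [set G : graphN_borel | partial_iso G s] `|`
    [set G | partial_iso G ((x, y) :: s)]).
  by apply: measurableU => //; exact: measurableC.
apply/seteqP; split=> G /=; last by move=> [|? _].
by move=> sG; have [/sG|] := pselect (partial_iso G s); [right|left].
Qed.

(** * Borel measurability of universality and of its clique-free variant *)

Definition hereditary (C : forall T : finType, rel T -> Prop) : Prop :=
  forall (T U : finType) (f : T -> U) (e : rel U),
    injective f -> C U e -> C T (relpre f e).

(** Finite functions into the naturals form a countable type, so the embedding is sought among
    them. *)
Lemma measurable_embeds (T : finType) (e : rel T) :
  measurable [set G : graphN_borel | embeds e G].
Proof.
rewrite (_ : [set G | _] = [set G | exists f : {ffun T -> nat},
    injective f /\ forall x y, adj G (f x) (f y) = e x y]).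
  apply: measurable_exists => f; apply: measurable_prop_and.
  apply: measurable_forall => x; apply: measurable_forall => y.
  by apply: measurable_eqb; [exact: measurable_adj|exact: measurable_cstP].
apply/seteqP; split=> G [f [f_inj fG]]; last by exists f.
exists [ffun x => f x]; split=> [x y|x y]; rewrite !ffunE//; exact: f_inj.
Qed.

(** Finite types do not form a countable family, but each finite graph has a copy on some ['I_n],
    and [hereditary] keeps this copy in the class [C]. The class is everything in the universal case
    and the clique-free graphs in the other. *)
Lemma measurable_embeds_all (C : forall T : finType, rel T -> Prop) :
  hereditary C ->
  measurable [set G : graphN_borel | forall (T : finType) (e : rel T),
    symmetric e -> irreflexive e -> C T e -> embeds e G].
Proof.
move=> hC; pose r n (e : {ffun 'I_n * 'I_n -> bool}) : rel 'I_n :=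
  fun x y => e (x, y).
rewrite (_ : [set G | _] = [set G | forall n (e : {ffun 'I_n * 'I_n -> bool}),
    symmetric (r n e) -> irreflexive (r n e) -> C 'I_n (r n e) ->
    embeds (r n e) G]).
  apply: measurable_forall => n; apply: measurable_forall => e.
  do 3!apply: measurable_prop_imply; exact: measurable_embeds.
apply/seteqP; split=> G GE => [n e|T e e_sym e_irr Ce]; first exact: GE.
pose e' := [ffun p : 'I_#|T| * 'I_#|T| => e (enum_val p.1) (enum_val p.2)].
have rE : r _ e' = relpre enum_val e.
  by apply/funext => x; apply/funext => y; rewrite /r ffunE.
have [] := GE _ e'.
- by move=> x y; rewrite rE /=.
- by move=> x; rewrite rE /=.
- by rewrite rE; exact: hC enum_val_inj Ce.
move=> f [f_inj fG]; exists (f \o enum_rank); split.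
  by move=> x y /f_inj /enum_rank_inj.
by move=> x y; rewrite /= fG rE /= !enum_rankK.
Qed.

Lemma measurable_universal : measurable [set G : graphN_borel | universal G].
Proof.
rewrite (_ : [set G | _] = [set G : graphN_borel | forall (T : finType) (e : rel T),
    symmetric e -> irreflexive e -> True -> embeds e G] `&`
  [set G | homogeneous G]).
  apply: measurableI; last exact: measurable_homogeneous.
  exact: (@measurable_embeds_all (fun _ _ => True)).
apply/seteqP; split=> G [GE Ghom]; split=> // T e e_sym e_irr; last exact: GE.
by move=> _; exact: GE.
Qed.

Lemma is_Kfree_hereditary s : hereditary (fun T => @is_Kfree s T).
Proof.
move=> T U f e f_inj Ke [g [g_inj ge]]; apply: Ke; exists (f \o g).
by split=> //; exact: inj_comp.
Qed.

Lemma measurable_Kfree s :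
  measurable [set G : graphN_borel | is_Kfree s (adj G)].
Proof.
apply: measurableC.
rewrite [X in measurable X](_ : _ = [set G : graphN_borel |
    exists f : {ffun 'I_s -> nat},
    injective f /\ forall i j, i != j -> adj G (f i) (f j)]).
  apply: measurable_exists => f; apply: measurable_prop_and.
  do 2!apply: measurable_forall => ?; apply: measurable_prop_imply.
  exact: measurable_adj.
apply/seteqP; split=> G [f [f_inj fG]]; last by exists f.
exists [ffun x => f x]; split=> [x y|x y]; rewrite !ffunE; first exact: f_inj.
exact: fG.
Qed.

Lemma measurable_Kfree_universal s :
  measurable [set G : graphN_borel | Kfree_universal s G].
Proof.
rewrite (_ : [set G | _] = [set G : graphN_borel | is_Kfree s (adj G)] `&`
  [set G | forall (T : finType) (e : rel T),
    symmetric e -> irreflexive e -> is_Kfree s e -> embeds e G] `&`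
  [set G | homogeneous G]).
  apply: measurableI; last exact: measurable_homogeneous.
  apply: measurableI; first exact: measurable_Kfree.
  apply: (@measurable_embeds_all (fun T => @is_Kfree s T)).
  exact: is_Kfree_hereditary.
by apply/seteqP; split=> G [] => [|[]] => *; split.
Qed.

(** * Infinite powers and the law of the sampled graph *)

Section infinite_power.
Context d (X : measurableType d) (R : realType).
Variables (m : probability X R) (P : probability (powN X) R).
Hypothesis mP : infinite_power m P.

Lemma measurable_coord i : measurable_fun setT ((fun x => x i) : powN X -> X).
Proof.
move=> _ A mA; rewrite setTI; apply: sub_sigma_algebra.
by exists i, A; split.
Qed.

Lemma measurable_fun_powN d' (T : measurableType d') (f : T -> powN X) :
  (forall i, measurable_fun setT (fun t => f t i)) -> measurable_fun setT f.
Proof.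
move=> mf; apply: (@measurability _ _ _ (powN X) _ _ (cylinders X) erefl).
by move=> _ [_ [i [A [mA ->]]] <-]; exact: mf.
Qed.

(** The pi-system on which [infinite_power] prescribes the measure. *)
Definition rectangles : set (set (powN X)) :=
  [set C | exists n (A : nat -> set X), (forall i, measurable (A i)) /\
    C = [set x | forall i, (i < n)%N -> A i (x i)]].

Lemma measurable_rectangle n (A : nat -> set X) : (forall i, measurable (A i)) ->
  measurable [set x : powN X | forall i, (i < n)%N -> A i (x i)].
Proof.
move=> mA; apply: measurable_forall => i; apply: measurable_prop_imply.
by rewrite -[X in measurable X]setTI; exact: measurable_coord.
Qed.

Lemma powN_measure_unique (P1 P2 : probability (powN X) R) :
  (forall C, rectangles C -> P1 C = P2 C) ->
  forall C, measurable C -> P1 C = P2 C.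
Proof.
move=> P12; apply: (measure_unique rectangles (fun=> setT)) => //.
- apply/seteqP; split; apply: smallest_sub; try exact: sigma_algebra_measurable.
  + exact: smallest_sigma_algebra.
  + move=> _ [i [A [mA ->]]]; apply: sub_sigma_algebra.
    (* A cylinder at coordinate [i] is a rectangle of length [i.+1] with full factors elsewhere. *)
    exists i.+1, (fun j => if j == i then A else setT).
    split=> [j|]; first by case: ifP.
    apply/seteqP; split=> x /=; first by move=> Ax j _; case: eqP => // ->.
    by move=> /(_ i (ltnSn i)); rewrite eqxx.
  + by move=> _ [n [A [mA ->]]]; exact: measurable_rectangle.
- move=> _ _ [n [A [mA ->]]] [k [B [mB ->]]].
  (* The guards drop the constraint of a rectangle beyond its own length. *)
  exists (maxn n k), (fun i => [set x | ((i < n)%N -> A i x) /\ ((i < k)%N -> B i x)]).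
  split=> [i|].
    by apply: measurableI; exact: measurable_prop_imply.
  apply/seteqP; split=> x /=; first by move=> [Ax Bx] i _; split=> [/Ax|/Bx].
  by move=> ABx; split=> i ii; have [|a b] := ABx i; rewrite ?leq_max ?ii ?orbT//;
    [exact: a|exact: b].
- move=> _; exists 0%N, (fun=> setT); split=> //.
  by apply/seteqP; split.
- by rewrite bigcup_const.
- by move=> k; rewrite [X in (X < _)%E]probability_setT ltry.
Qed.

(** Passes from initial segments to any finite family of distinct coordinates, by padding with full
    factors. *)
Lemma infinite_power_finite (J : finType) (f : J -> nat) (A : J -> set X) :
  injective f -> (forall j, measurable (A j)) ->
  P [set x | forall j, A j (x (f j))] = (\prod_j m (A j))%E.
Proof.
move=> f_inj mA.
pose n := (\max_j f j).+1.
have fn j : (f j < n)%N by rewrite ltnS (leq_bigmax j).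
(* By injectivity this is [A j] at [f j]; off the image of [f] it is the whole space and contributes
   a factor 1. *)
pose B i := [set x | forall j, f j = i -> A j x].
have Bf j : B (f j) = A j.
  apply/seteqP; split=> [x|x Ax k /f_inj -> //]; exact.
have mB i : measurable (B i).
  apply: measurable_forall => j; exact: measurable_prop_imply.
rewrite (_ : [set x | _] = [set x | forall i, (i < n)%N -> B i (x i)]); last first.
  apply/seteqP; split=> x /=.
    by move=> Ax i _ j <-.
  by move=> Bx j; rewrite -Bf; exact: Bx.
rewrite mP//.
rewrite (bigID (fun i : 'I_n => i \in codom (fun j => Ordinal (fn j)))) /=.
rewrite [X in (_ * X)%E]big1 ?mule1; last first.
  move=> i i_f; rewrite (_ : B i = setT) ?probability_setT//.
  apply/seteqP; split=> // x _ j fji; case/negP: i_f.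
  by apply/codomP; exists j; exact: val_inj.
have h_uniq : uniq (codom (fun j => Ordinal (fn j))).
  by apply/injectiveP => j k /(congr1 val) /f_inj.
rewrite -big_uniq//= /image_mem big_map big_enum /=.
by apply: eq_bigr => j _; rewrite Bf.
Qed.

(** Both measures agree on products [A1] times [A2], by the finite-coordinate formula indexed by
    [bool], and these determine the product measure. *)
Lemma infinite_power_pair i j : i != j -> forall B, measurable B ->
  P ((fun x => (x i, x j)) @^-1` B) = (m \x m)%E B.
Proof.
move=> ij B mB.
have mf : measurable_fun setT ((fun x => (x i, x j)) : powN X -> X * X).
  by apply: measurable_fun_pair; exact: measurable_coord.
pose F : {mfun powN X >-> (X * X)%type} :=
  HB.pack (fun x : powN X => (x i, x j)) (isMeasurableFun.Build _ _ _ _ _ mf).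
apply/esym/(@product_measure_unique _ _ _ _ _ m m (distribution P F)) => //.
move=> A1 A2 mA1 mA2.
pose f (b : bool) := if b then i else j.
have f_inj : injective f.
  by move=> [] [] // /eqP; rewrite /f ?(negbTE ij)// eq_sym (negbTE ij).
transitivity (P [set x | forall b, (if b then A1 else A2) (x (f b))]).
  congr (P _); apply/seteqP; split=> [x [Ax1 Ax2] []//|x Ax]; split;
  [exact: (Ax true)|exact: (Ax false)].
rewrite (@infinite_power_finite _ f (fun b : bool => if b then A1 else A2))//.
  by rewrite big_bool.
by case.
Qed.

Definition permute (sigma : nat -> nat) (x : powN X) : powN X :=
  fun i => x (sigma i).

Lemma measurable_permute sigma : measurable_fun setT (permute sigma).
Proof. by apply: measurable_fun_powN => i; exact: measurable_coord. Qed.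

(** The mass of a rectangle depends on its factors and not on which distinct coordinates carry
    them. *)
Lemma infinite_power_permute sigma : injective sigma ->
  forall C, measurable C -> P (permute sigma @^-1` C) = P C.
Proof.
move=> sigma_inj.
pose F : {mfun powN X >-> powN X} := HB.pack (permute sigma)
  (isMeasurableFun.Build _ _ _ _ _ (measurable_permute sigma)).
apply: (@powN_measure_unique (distribution P F)) => _ [n [A [mA ->]]].
transitivity (P [set x | forall k : 'I_n, A k (x (sigma k))]).
  congr (P _); apply/seteqP; split=> x /= Ax; first by move=> k; exact: Ax.
  by move=> k kn; exact: (Ax (Ordinal kn)).
rewrite mP// (@infinite_power_finite _ (fun k : 'I_n => sigma k) (fun k : 'I_n => A k))//.
by move=> k l /sigma_inj /val_inj.
Qed.

End infinite_power.

Lemma graphN_eq (G H : graphN) : (forall i j, adj G i j = adj H i j) -> G = H.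
Proof.
case: G H => [a a_sym a_irr] [b b_sym b_irr] /= ab.
have {}ab : a = b by apply/funext => i; apply/funext => j.
by case: _ / ab in b_sym b_irr *; congr GraphN; exact: Prop_irrelevance.
Qed.

Section graph_law.
Context d (X : measurableType d) (R : realType).
Variables (m : probability X R) (P : probability (powN X) R).
Variable E : measurable_graph m.
Hypothesis mP : infinite_power m P.

Let cX : measurableType _ := caratheodory_type (P^*)%mu.

(** Off the diagonal, the event of an edge is the preimage of [edges E] under a pair of coordinates,
    which carries [P] to the product measure. *)
Lemma measurable_sample_graph : measurable_fun [set: cX] (sample_graph E).
Proof.
apply: (@measurable_fun_graph _ cX) => i j; rewrite /= /sample_adj.
have [->|ij] := eqVneq i j.
  by rewrite (_ : [set _ | _] = set0)//; apply/seteqP; split.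
rewrite (_ : [set _ | _] = (fun x => (x i, x j)) @^-1` edges E); last first.
  by apply/seteqP; split=> x /=; rewrite asboolE.
have mf : measurable_fun setT ((fun x => (x i, x j)) : powN X -> X * X).
  by apply: measurable_fun_pair; exact: measurable_coord.
exact: (cara_preimage mf (infinite_power_pair mP ij) (edges_measurable E)).1.
Qed.

(** Injectivity matches the diagonals, where the sampled adjacency is forced to be false. *)
Lemma relabel_sample_graph sigma (x : powN X) : injective sigma ->
  relabel sigma (sample_graph E x) = sample_graph E (permute sigma x).
Proof.
move=> sigma_inj; apply: graphN_eq => i j /=.
by rewrite /sample_adj (inj_eq sigma_inj).
Qed.

Lemma completed_setT : completed P setT = 1%E.
Proof. by rewrite -(probability_setT P); exact: measurable_mu_extE. Qed.

HB.instance Definition _ := Measure_isProbability.Build _ _ _ (completed P) completed_setT.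

(** Common to both cases, with [U] the set of universal or of clique-free universal graphs; the law
    is the image of the completion of [P]. *)
Lemma graph_law_exists (U : set graphN_borel) : measurable U ->
  {ae P, forall x, U (sample_graph E x)} ->
  exists mu : probability graphN_borel R,
    [/\ is_graph_law P E mu, perm_invariant mu & {ae mu, forall G, U G}].
Proof.
move=> mU PU.
pose cP : probability cX R := completed P.
pose F : {mfun cX >-> graphN_borel} := HB.pack (sample_graph E : cX -> graphN_borel)
  (isMeasurableFun.Build _ _ _ _ _ measurable_sample_graph).
exists (distribution cP F); split.
- by split=> //; exact: measurable_sample_graph.
- move=> sigma /bij_inj sigma_inj C mC.
  have mFC : (P^*)%mu.-cara.-measurable (sample_graph E @^-1` C).
    by rewrite -[X in measurable X]setTI; exact: measurable_sample_graph.
  (* The event is only measurable for the completion, so invariance of [P] on Borel events is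
     transferred by [cara_preimage]. *)
  apply: etrans (cara_preimage (measurable_permute sigma)
    (infinite_power_permute mP sigma_inj) mFC).2.
  congr ((P^*)%mu _); apply/seteqP; split=> x /=;
    by rewrite relabel_sample_graph.
(* The complement of [U] is Borel, and its preimage lies in a [P]-null set. *)
- exists (~` U); split=> //; first exact: measurableC.
  rewrite -[LHS]/(completed P (sample_graph E @^-1` (~` U))); case: PU => N [mN N0 UN].
  exact: mu_ext_sub_null mN N0 UN.
Qed.

End graph_law.

Theorem theorem3 (R : realType) (d : measure_display) (X : measurableType d)
    (m : probability X R) (P : probability (powN X) R)
    (E : measurable_graph m) :
  standard_lebesgue_space m -> atomless m -> infinite_power m P ->
  (universal_measurable_graph P E ->
     exists mu : probability graphN_borel R,
       [/\ is_graph_law P E mu,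
           perm_invariant mu &
           {ae mu, forall G, universal G}]) /\
  (forall s : nat, (2 < s)%N ->
     Kfree_universal_measurable_graph s P E ->
     exists mu : probability graphN_borel R,
       [/\ is_graph_law P E mu,
           perm_invariant mu &
           {ae mu, forall G, Kfree_universal s G}]).
Proof.
move=> _ _ mP; split=> [[_ PU]|s _ [_ PU]].
  exact: (graph_law_exists mP measurable_universal).
exact: (graph_law_exists mP (measurable_Kfree_universal s)).
Qed.
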